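(* Let $n\ge3$, and assume that we observe the random vector $\boldsymbol y=\boldsymbol f^*+\boldsymbol\xi$, where $\boldsymbol f^*\in\mathbb R^n$ is fixed and $\boldsymbol\xi\sim\mathcal N_n(0,\sigma^{*2}\mathbf I_n)$ with $\sigma^*>0$. Let $\delta>0$ be a constant with $\delta<n$, and let $k$ be the smallest integer larger than $\big(\|\boldsymbol f^\uparrow\|_{\rm TV}^2\,n\log(n/\delta)/\sigma^{*2}\big)^{1/3}$, where $\boldsymbol f^\uparrow$ is the orthogonal projection of $\boldsymbol f^*$ on the convex polyhedral cone of vectors of $\mathbb R^n$ with nondecreasing entries. Then, for the tuning parameter $\lambda=\sigma^*\sqrt{\log(n/\delta)/(kn)}$, the TV-estimator fulfills $$\frac1n\|\widehat{\boldsymbol f}^{\rm TV}-\boldsymbol f^*\|_2^2\le\frac1n\|\boldsymbol f^\uparrow-\boldsymbol f^*\|_2^2+\frac{2\sigma^{*2}(1+2\log(1/\delta))}{n}+6\Big(\frac{\sigma^{*4}\|\boldsymbol f^\uparrow\|_{\rm TV}^2\log(n/\delta)}{n^2}\Big)^{1/3}$$ with probability at least $1-2\delta$.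
   Context: For $\boldsymbol f\in\mathbb R^n$, $\|\boldsymbol f\|_{\rm TV}=\sum_{i=1}^n|f_i-f_{i-1}|$ with the convention $f_0=0$. The TV-estimator with tuning parameter $\lambda>0$ is $\widehat{\boldsymbol f}^{\rm TV}\in\arg\min_{\boldsymbol f\in\mathbb R^n}\{\frac1{2n}\|\boldsymbol y-\boldsymbol f\|_2^2+\lambda\|\boldsymbol f\|_{\rm TV}\}$; equivalently, $\widehat{\boldsymbol f}^{\rm TV}=\mathbf X\widehat{\boldsymbol\beta}_\lambda$ with $\widehat{\boldsymbol\beta}_\lambda\in\arg\min_{\boldsymbol\beta}\{\frac1{2n}\|\boldsymbol y-\mathbf X\boldsymbol\beta\|_2^2+\lambda\|\boldsymbol\beta\|_1\}$ and $\mathbf X=(\mathbf 1\{i\ge j\})_{i,j=1}^n$. *)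

(* Defs.v *)
From mathcomp Require Import all_boot all_order all_algebra.
From mathcomp Require Import all_classical all_reals all_analysis.

Set Implicit Arguments.
Unset Strict Implicit.
Unset Printing Implicit Defensive.

Import Order.TTheory GRing.Theory Num.Theory.
Local Open Scope classical_set_scope.
Local Open Scope ring_scope.

(* Squared Euclidean norm; the library norm `|u| on matrices is the sup norm. *)
Definition sqnorm2 (R : realType) (n : nat) (u : 'cV[R]_n) : R :=
  \sum_(i < n) u i 0 ^+ 2.

(* The entry preceding index 0 is taken to be 0, so |f_1| is part of the
   sum and TV is a norm. [ord_pred] is cyclic, but it is only used here at
   nonzero indices, where it is the ordinary predecessor. *)
Definition TV (R : realType) (n : nat) (f : 'cV[R]_n) : R :=
  \sum_(i < n) `|f i 0 - (if val i == 0%N then 0 else f (ord_pred i) 0)|.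

Definition argmin (V : Type) (R : realType) (A : set V) (F : V -> R) : set V :=
  [set x | A x /\ forall z, A z -> F x <= F z].

Definition nondecreasing_cone (R : realType) (n : nat) : set 'cV[R]_n :=
  [set f | forall i j : 'I_n, (i <= j)%N -> f i 0 <= f j 0].

Definition is_projection (R : realType) (n : nat) (C : set 'cV[R]_n)
    (f p : 'cV[R]_n) : Prop :=
  argmin C (fun g => sqnorm2 (g - f)) p.

Definition TV_estimator (R : realType) (n : nat) (lambda : R) (y f : 'cV[R]_n)
    : Prop :=
  argmin setT
    (fun g => (2 * n%:R)^-1 * sqnorm2 (y - g) + lambda * TV g) f.

Definition mutually_independent (d : measure_display) (T : measurableType d)
    (R : realType) (P : probability T R) (I : finType)
    (X : I -> {RV P >-> R}) : Prop :=
  forall (J : {set I}) (B : I -> set R),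
    (forall i, i \in J -> measurable (B i)) ->
    P (\bigcap_(i in [set` J]) (X i @^-1` B i)) =
    (\prod_(i in J) P (X i @^-1` B i))%E.

(* The law N_n(0, sigma^2 I_n). The second parameter of [normal_prob] is the
   standard deviation. Laws are compared on measurable sets only, since their
   values elsewhere are meaningless. *)
Definition isotropic_gaussian (d : measure_display) (T : measurableType d)
    (R : realType) (P : probability T R) (n : nat) (sigma : R)
    (xi : 'I_n -> {RV P >-> R}) : Prop :=
  (forall (i : 'I_n) (B : set R), measurable B ->
     distribution P (xi i) B = normal_prob 0 sigma B) /\
  mutually_independent xi.

Definition smallest_integer_larger (R : realType) (x : R) (k : int) : Prop :=
  x < k%:~R /\ forall j : int, x < j%:~R -> k <= j.

(* Main.v *)
Require Import Defs.
From HB Require Import structures.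
From mathcomp Require Import all_boot all_order all_algebra.
From mathcomp Require Import all_classical all_reals all_analysis.
From mathcomp Require Import measurable_realfun.
From mathcomp Require Import ring lra zify.

Set Implicit Arguments.
Unset Strict Implicit.
Unset Printing Implicit Defensive.

Import Order.TTheory GRing.Theory Num.Theory.
Local Open Scope classical_set_scope.
Local Open Scope ring_scope.

(** Write [h = fhat - fup] and [y = fstar + noise]. The objective is a quadratic
plus a convex function, so its minimiser satisfies a variational inequality
([TV_estimator_variational]) which, tested against [fup], bounds the loss of
[fhat] by the loss of [fup] plus
[2 <noise, h> - |h|^2 + 2 n lambda (TV fup - TV fhat)].
The noise term is split along a subspace of dimension at most [k], the vectors
that are constant on consecutive blocks of length [m], the ceiling of [n / k].

The projection of the noise on that subspace is paired with [h] by Young's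
inequality and the Bessel inequality: this uses up [|h|^2] and leaves a
chi-square variable with at most [k] degrees of freedom. The residual of the
noise is paired with [h] by Abel summation: it costs at most [TV h] times the
largest of the [|<step j - proj (step j), noise>|]. When all of these are at
most [n lambda], the triangle inequality for TV turns the penalty terms into
[4 n lambda TV fup]. This is [TV_estimator_oracle]. The choice of [k] balances
[lambda TV fup] against [sigma^2 k / n] ([rate_scaling], [penalty_le_rate]).

Both random quantities are controlled by exponential moments. The product rule
for events extends to products of functions ([indep_integral_prod]), which gives
the Laplace transform of every linear form ([gaussian_linear_mgf]). The
exponential moment of the chi-square variable follows without knowing the joint
law of the projections: [exp (z^2 / 4)] is the average of [exp (g z / sqrt 2)]
over a standard normal [g], so squares can be traded one at a time for linear
terms by Tonelli's theorem ([gaussian_quadratic_mgf]).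

The union bound over the [n] residuals has no room for the factor 2 of a
two-sided tail when [k] is close to [n]: a block of length 2 leaves a squared
residual of 1/2, and [n / (2 k)] may be barely above it. There, however, only
one index in each block has a nonzero residual, which gains the factor back.
For blocks of length at least 3 the squared residuals are at most [n / (3 k)],
two thirds of what the level of [lambda] allows, and this absorbs the 2. This is
[residual_tail] and [sum_bad_prob].

Finally the event must be measurable for its probability to be meaningful. The
estimator is a nonexpansive function of the data, so its entries depend
continuously on the noise ([TV_estimator_nonexpansive],
[measurable_fun_of_coordinates]). *)

(** * Integrals against weighted laws *)

Section weighted_law.
Context d1 d2 dU (T1 : measurableType d1) (T2 : measurableType d2)
  (U : measurableType dU) (R : realType).
Local Open Scope ereal_scope.
Import HBNNSimple.

Lemma integral_weighted_limn d (T : measurableType d)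
    (m : {measure set T -> \bar R}) (W : T -> R) (X : T -> U) (f : U -> R)
    (mf : measurable_fun [set: U] (EFin \o f)) :
  measurable_fun setT W -> (forall t, (0 <= W t)%R) ->
  measurable_fun setT X -> (forall u, (0 <= f u)%R) ->
  \int[m]_t (W t * f (X t))%:E =
  limn (fun n => \int[m]_t (W t * nnsfun_approx measurableT mf n (X t))%:E).
Proof.
move=> mW W0 mX f0; set g := nnsfun_approx measurableT mf.
rewrite -monotone_convergence//; last 3 first.
- move=> n; apply/measurable_EFinP; apply: measurable_funM => //.
  exact: measurableT_comp.
- by move=> n t _; rewrite lee_fin mulr_ge0.
- move=> t _ a b ab; rewrite lee_fin ler_wpM2l//.
  exact/lefP/nd_nnsfun_approx.
apply: eq_integral => t _; apply/esym/cvg_lim => //.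
rewrite EFinM; under eq_fun do rewrite EFinM.
apply: cvgeZl => //.
by apply: (@cvg_nnsfun_approx _ _ _ _ measurableT _ mf) => // x _; rewrite lee_fin.
Qed.

Lemma integral_weighted_nnsfun d (T : measurableType d)
    (m : {measure set T -> \bar R}) (W : T -> R) (X : T -> U)
    (f : {nnsfun U >-> R}) :
  measurable_fun setT W -> (forall t, (0 <= W t)%R) ->
  measurable_fun setT X ->
  \int[m]_t (W t * f (X t))%:E =
  \sum_(r \in range f) r%:E * \int[m]_t (W t * \1_(f @^-1` [set r]) (X t))%:E.
Proof.
move=> mW W0 mX.
have mI r : measurable_fun setT (fun t => \1_(f @^-1` [set r]) (X t) : R).
  by apply: measurableT_comp => //; exact: measurable_indic.
have mWI r : measurable_fun setT
    (fun t => (W t * \1_(f @^-1` [set r]) (X t))%:E).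
  by apply/measurable_EFinP; apply: measurable_funM.
have r0 r t : (0 <= r * (W t * \1_(f @^-1` [set r]) (X t)))%R.
  rewrite mulrCA mulr_ge0//.
  by have := @nnfun_muleindic_ge0 _ _ _ f r (X t); rewrite lee_fin.
under eq_integral => t _.
  rewrite fimfunE fsbig_finite//= mulr_sumr -sumEFin.
  under eq_bigr do rewrite mulrCA.
  over.
rewrite ge0_integral_sum//; last 2 first.
- by move=> r; apply/measurable_EFinP; apply: measurable_funM => //;
    exact: measurable_funM.
- by move=> r t _; rewrite lee_fin.
rewrite fsbig_finite//=; apply: eq_bigr => r _.
have [r_lt0|r_ge0] := ltP r 0%R.
  rewrite preimage_nnfun0//.
  under eq_integral do rewrite indic0 /= !mulr0.
  by under [in RHS]eq_integral do rewrite indic0 mulr0; rewrite integral0 mule0.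
under eq_integral do rewrite EFinM.
by rewrite ge0_integralZl_EFin// => t _; rewrite lee_fin mulr_ge0.
Qed.

(** A density transfer principle: two weighted image measures which agree on
measurable sets have the same integrals of nonnegative functions. Weights on
both sides let it serve as the change of variables to a density and as the
step that replaces one factor of a product of independent variables. *)
Lemma eq_weighted_law (m1 : {measure set T1 -> \bar R})
    (m2 : {measure set T2 -> \bar R})
    (W1 : T1 -> R) (X1 : T1 -> U) (W2 : T2 -> R) (X2 : T2 -> U) (f : U -> R) :
  measurable_fun setT W1 -> (forall t, (0 <= W1 t)%R) -> measurable_fun setT X1 ->
  measurable_fun setT W2 -> (forall t, (0 <= W2 t)%R) -> measurable_fun setT X2 ->
  measurable_fun setT f -> (forall u, (0 <= f u)%R) ->
  (forall B, measurable B -> \int[m1]_t (W1 t * \1_B (X1 t))%:E =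
                             \int[m2]_t (W2 t * \1_B (X2 t))%:E) ->
  \int[m1]_t (W1 t * f (X1 t))%:E = \int[m2]_t (W2 t * f (X2 t))%:E.
Proof.
move=> mW1 W10 mX1 mW2 W20 mX2 mf f0 eqB.
have mf' : measurable_fun setT (EFin \o f) by exact/measurable_EFinP.
rewrite !(@integral_weighted_limn _ _ _ _ _ f mf')//.
congr (limn _); apply/funext => n.
rewrite !integral_weighted_nnsfun//.
by apply: eq_fsbigr => r _; rewrite eqB.
Qed.

End weighted_law.

(** * Independent variables and products of functions *)

Lemma measurable_comp_rv d (T : measurableType d) (R : realType)
    (P : probability T R) (X : {RV P >-> R}) (f : R -> R) :
  measurable_fun setT f -> measurable_fun setT (fun w => f (X w)).
Proof. by move=> mf; apply: measurableT_comp. Qed.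

Lemma indep_integral_indic_prod d (T : measurableType d) (R : realType)
    (P : probability T R) (I : finType) (xi : I -> {RV P >-> R})
    (B : I -> set R) :
  mutually_independent xi -> (forall i, measurable (B i)) ->
  (\int[P]_w (\prod_i \1_(B i) (xi i w))%:E = \prod_i P (xi i @^-1` B i))%E.
Proof.
move=> ind mB.
have := ind (finset.setTfor I) B (fun i _ => mB i).
rewrite (eq_bigl xpredT); last by move=> i; rewrite inE.
move=> <-.
have mA : measurable (\bigcap_(i in [set` finset.setTfor I]) (xi i @^-1` B i)).
  apply: fin_bigcap_measurable; first exact: finite_finset.
  by move=> i _; rewrite -[_ @^-1` _]setTI; exact: measurable_funP.
rewrite -[in RHS](setIT (\bigcap_(i in _) _)) -integral_indic//.
apply: eq_integral => w _; congr EFin.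
rewrite [RHS]indicE; case: (boolP (w \in _)) => [|].
  rewrite inE => Bw; rewrite big1// => i _.
  by rewrite indicE mem_set//; apply: Bw => /=; rewrite inE.
rewrite notin_setE => /existsNP[i /not_implyP[_ nB]].
by rewrite (bigD1 i)//= indicE memNset// mul0r.
Qed.

(** The product rule is known for indicators; the indices are freed from that
restriction one at a time. With the other factors gathered in a weight [W],
both sides are image measures in the factor being freed, and they agree on
indicators by induction. *)
Lemma indep_integral_prod d (T : measurableType d) (R : realType)
    (P : probability T R) n (xi : 'I_n -> {RV P >-> R})
    (f : 'I_n -> R -> R) (e : 'I_n -> R) :
  mutually_independent xi ->
  (forall i, measurable_fun setT (f i)) -> (forall i x, 0 <= f i x) ->
  (forall i, (\int[P]_w (f i (xi i w))%:E = (e i)%:E)%E) ->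
  (\int[P]_w (\prod_i f i (xi i w))%:E = (\prod_i e i)%:E)%E.
Proof.
move=> ind.
suff aux k : (k <= n)%N -> forall (f : 'I_n -> R -> R) (e : 'I_n -> R),
    (forall i, measurable_fun setT (f i)) -> (forall i x, 0 <= f i x) ->
    (forall i, (\int[P]_w (f i (xi i w))%:E = (e i)%:E)%E) ->
    (forall i : 'I_n, (k <= i)%N -> exists2 B, measurable B & f i = \1_B) ->
    (\int[P]_w (\prod_i f i (xi i w))%:E = (\prod_i e i)%:E)%E.
  move=> mf f0 fe; apply: (aux n) => // i.
  by rewrite leqNgt ltn_ord.
elim: k => [_|k IH kn] {}f {}e mf f0 fe fB.
  have /choice[B Bf] : forall i, exists B, measurable B /\ f i = \1_B.
    by move=> i; have [B] := fB i isT; exists B.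
  have fE : f = (fun i => \1_(B i)).
    by apply/funext => i; case: (Bf i).
  rewrite [in LHS]fE indep_integral_indic_prod//; last by move=> i; exact: (Bf i).1.
  rewrite -prodEFin; apply: eq_bigr => i _; rewrite -fe (Bf i).2.
  rewrite -[LHS]/(P (xi i @^-1` B i)) -[in LHS](setIT (_ @^-1` _)).
  rewrite -integral_indic//.
  by rewrite -[_ @^-1` _]setTI; apply: measurable_funP => //; exact: (Bf i).1.
(* The factor of index [k] is the one freed at this step. *)
pose i0 := Ordinal kn.
have e0 i : 0 <= e i.
  by rewrite -lee_fin -fe; apply: integral_ge0 => w _; rewrite lee_fin.
pose W w := \prod_(i | i != i0) f i (xi i w).
have mW : measurable_fun setT W.
  have -> : W = (fun w => \prod_i (if i != i0 then f i (xi i w) else 1)).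
    by apply/funext => w; rewrite /W big_mkcond.
  apply: measurable_prod => i _; case: (i != i0) => //.
  exact: measurable_comp_rv.
have W0 w : 0 <= W w by apply: prodr_ge0.
pose c := \prod_(i | i != i0) e i.
have c0 : 0 <= c by apply: prodr_ge0.
transitivity (\int[P]_w (W w * f i0 (xi i0 w))%:E)%E.
  by apply: eq_integral => w _; rewrite (bigD1 i0)//= mulrC.
rewrite (@eq_weighted_law _ _ _ _ _ _ _ P P W (xi i0) (cst c) (xi i0))//=.
  under eq_integral do rewrite EFinM.
  rewrite ge0_integralZl_EFin//; last 2 first.
  - by move=> w _; rewrite lee_fin.
  - by apply/measurable_EFinP; exact: measurable_comp_rv.
  by rewrite fe -EFinM (bigD1 i0)//= mulrC.
move=> B mB.
pose f' i := if i == i0 then \1_B else f i.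
pose e' i := if i == i0 then fine (P (xi i0 @^-1` B)) else e i.
have mXB : measurable (xi i0 @^-1` B).
  by rewrite -[_ @^-1` _]setTI; apply: measurable_funP.
have intB : (\int[P]_w (\1_B (xi i0 w))%:E = (fine (P (xi i0 @^-1` B)))%:E)%E.
  rewrite fineK ?fin_num_measure//.
  by rewrite -[in RHS](setIT (_ @^-1` _)) -integral_indic.
have prod_e' : \prod_i e' i = fine (P (xi i0 @^-1` B)) * c.
  rewrite (bigD1 i0)//= {1}/e' eqxx; congr (_ * _).
  by apply: eq_bigr => i /negbTE ii0; rewrite /e' ii0.
transitivity (\int[P]_w (\prod_i f' i (xi i w))%:E)%E.
  apply: eq_integral => w _; rewrite [in RHS](bigD1 i0)//= {1}/f' eqxx mulrC.
  by congr (_ * _)%:E; apply: eq_bigr => i /negbTE ii0; rewrite /f' ii0.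
rewrite (IH (ltnW kn) f' e') ?prod_e'.
- under [RHS]eq_integral do rewrite EFinM.
  rewrite ge0_integralZl_EFin//; first by rewrite intB -EFinM mulrC.
  by apply/measurable_EFinP; apply: measurable_comp_rv; exact: measurable_indic.
- by move=> i; rewrite /f'; case: ifP.
- by move=> i x; rewrite /f'; case: ifP.
- by move=> i; rewrite /f' /e'; case: ifPn => // /eqP->.
move=> i ki; rewrite /f'; case: ifPn => [_|ii0]; first by exists B.
apply: fB; rewrite ltn_neqAle ki andbT.
by apply: contraNneq ii0 => kE; apply/eqP/val_inj.
Qed.

(** * Euclidean geometry of column vectors *)

Definition dot (R : realType) (n : nat) (u v : 'cV[R]_n) : R :=
  \sum_(i < n) u i 0 * v i 0.

Section dot_product.
Context (R : realType) (n : nat).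
Implicit Types u v w : 'cV[R]_n.

Lemma dotC u v : dot u v = dot v u.
Proof. by apply: eq_bigr => i _; rewrite mulrC. Qed.

Lemma dotDr w u v : dot w (u + v) = dot w u + dot w v.
Proof. by rewrite -big_split; apply: eq_bigr => i _; rewrite mxE mulrDr. Qed.

Lemma dotZr a u v : dot u (a *: v) = a * dot u v.
Proof. by rewrite mulr_sumr; apply: eq_bigr => i _; rewrite mxE mulrCA. Qed.

Lemma dotNr u v : dot u (- v) = - dot u v.
Proof. by rewrite -scaleN1r dotZr mulN1r. Qed.

Lemma dotBr w u v : dot w (u - v) = dot w u - dot w v.
Proof. by rewrite dotDr dotNr. Qed.

Lemma dotDl w u v : dot (u + v) w = dot u w + dot v w.
Proof. by rewrite dotC dotDr !(dotC w). Qed.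

Lemma dotZl a u v : dot (a *: u) v = a * dot u v.
Proof. by rewrite dotC dotZr dotC. Qed.

Lemma dotBl w u v : dot (u - v) w = dot u w - dot v w.
Proof. by rewrite dotC dotBr !(dotC w). Qed.

Lemma dot0r u : dot u 0 = 0.
Proof. by rewrite -(scale0r u) dotZr mul0r. Qed.

Lemma dot_sumr u m (F : nat -> 'cV[R]_n) :
  dot u (\sum_(b < m) F b) = \sum_(b < m) dot u (F b).
Proof.
elim: m => [|m IH]; first by rewrite !big_ord0 dot0r.
by rewrite !big_ord_recr dotDr IH.
Qed.

Lemma sqnorm2E u : sqnorm2 u = dot u u.
Proof. by apply: eq_bigr => i _; rewrite expr2. Qed.

Lemma sqnorm2_ge0 u : 0 <= sqnorm2 u.
Proof. by apply: sumr_ge0 => i _; rewrite sqr_ge0. Qed.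

Lemma sqnorm2D u v : sqnorm2 (u + v) = sqnorm2 u + 2 * dot u v + sqnorm2 v.
Proof. by rewrite !sqnorm2E dotDl !dotDr (dotC v u); ring. Qed.

Lemma sqnorm2B u v : sqnorm2 (u - v) = sqnorm2 u - 2 * dot u v + sqnorm2 v.
Proof. by rewrite !sqnorm2E dotBl !dotBr (dotC v u); ring. Qed.

Lemma sqnorm2Z a u : sqnorm2 (a *: u) = a ^+ 2 * sqnorm2 u.
Proof. by rewrite !sqnorm2E dotZl dotZr; ring. Qed.

End dot_product.

(** Families are indexed by [nat] with a bound, so that inductions on the number
of vectors need no change of index type. *)
Definition orthonormal_upto (R : realType) (n d : nat) (u : nat -> 'cV[R]_n) :=
  forall a b, (a < d)%N -> (b < d)%N -> dot (u a) (u b) = (a == b)%:R.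

Definition proj (R : realType) (n d : nat) (u : nat -> 'cV[R]_n) (h : 'cV[R]_n)
  : 'cV[R]_n := \sum_(b < d) dot (u b) h *: u b.

Section projection.
Context (R : realType) (n d : nat) (u : nat -> 'cV[R]_n).
Implicit Types h x : 'cV[R]_n.

Lemma dot_proj x h : dot x (proj d u h) = \sum_(b < d) dot (u b) x * dot (u b) h.
Proof.
rewrite (dot_sumr x d (fun b => dot (u b) h *: u b)).
by apply: eq_bigr => b _; rewrite dotZr mulrC (dotC x).
Qed.

Lemma proj_residual_adjoint x h :
  dot x (h - proj d u h) = dot (x - proj d u x) h.
Proof.
rewrite dotBr dotBl (dotC (proj _ _ _)) !dot_proj; congr (_ - _).
by apply: eq_bigr => b _; rewrite mulrC.
Qed.

Hypothesis ou : orthonormal_upto d u.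

(** Pythagoras; nonnegativity of the left-hand side is the Bessel inequality. *)
Lemma sqnorm2_proj_residual h :
  sqnorm2 (h - proj d u h) = sqnorm2 h - \sum_(b < d) dot (u b) h ^+ 2.
Proof.
have projE : dot h (proj d u h) = \sum_(b < d) dot (u b) h ^+ 2.
  by rewrite dot_proj; apply: eq_bigr => b _; rewrite expr2.
have uproj (a : 'I_d) : dot (u a) (proj d u h) = dot (u a) h.
  rewrite dot_proj (bigD1 a)//= ou ?ltn_ord// eqxx mul1r big1 ?addr0// => b ba.
  by rewrite ou ?ltn_ord// (inj_eq val_inj) (negbTE ba) mul0r.
have projproj : sqnorm2 (proj d u h) = \sum_(b < d) dot (u b) h ^+ 2.
  rewrite sqnorm2E dot_proj; apply: eq_bigr => b _.
  by rewrite uproj expr2.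
by rewrite sqnorm2B projproj projE; ring.
Qed.

End projection.

(** * Exponential moments of Gaussian noise *)

(** Completing the square: tilting the centred normal density by [expR (t * x)]
gives a multiple of the density of mean [s ^+ 2 * t]. *)
Lemma gaussian_mgf_integral (R : realType) (s t : R) : s != 0 ->
  (\int[lebesgue_measure]_x (normal_pdf 0 s x * expR (t * x))%:E =
   (expR (s ^+ 2 * t ^+ 2 / 2))%:E)%E.
Proof.
move=> s0.
transitivity (\int[lebesgue_measure]_x
    ((expR (s ^+ 2 * t ^+ 2 / 2))%:E * (normal_pdf (s ^+ 2 * t) s x)%:E))%E.
  apply: eq_integral => x _; rewrite -EFinM; congr EFin.
  rewrite !normal_pdfE// [RHS]mulrCA -[LHS]mulrA; congr (_ * _).
  by rewrite /normal_fun -!expRD; congr expR; rewrite -mulr_natr; field.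
rewrite ge0_integralZl_EFin//.
- by rewrite integral_normal_pdf mule1.
- by move=> x _; rewrite lee_fin normal_pdf_ge0.
- by apply/measurable_EFinP; exact: measurable_normal_pdf.
Qed.

(** The factor [expR (x ^+ 2 / 4)] halves the exponent of the standard density,
that is, doubles its variance. *)
Lemma gaussian_exp_sq_integral (R : realType) :
  (\int[lebesgue_measure]_x (normal_pdf (0 : R) 1 x * expR (x ^+ 2 / 4))%:E =
   (Num.sqrt 2)%:E)%E.
Proof.
have s20 : Num.sqrt 2 != 0 :> R by rewrite sqrtr_eq0 -ltNge.
transitivity (\int[lebesgue_measure]_x
    ((Num.sqrt 2)%:E * (normal_pdf (0 : R) (Num.sqrt 2) x)%:E))%E.
  apply: eq_integral => x _; rewrite -EFinM; congr EFin.
  rewrite !normal_pdfE ?oner_neq0//.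
  have peakE : normal_peak (1 : R) = Num.sqrt 2 * normal_peak (Num.sqrt 2).
    rewrite /normal_peak sqr_sqrtr// expr1n mul1r -mulrnAr sqrtrM// invfM.
    by rewrite mulVKf.
  rewrite peakE -!mulrA; congr (_ * (_ * _)).
  rewrite /normal_fun -!expRD; congr expR.
  by rewrite (@sqr_sqrtr R 2)// !mulr2n subr0 expr1n; field.
rewrite ge0_integralZl_EFin//.
- by rewrite integral_normal_pdf mule1.
- by move=> x _; rewrite lee_fin normal_pdf_ge0.
- by apply/measurable_EFinP; exact: measurable_normal_pdf.
Qed.

Section gaussian_vector.
Context (d : measure_display) (T : measurableType d) (R : realType)
  (P : probability T R) (n : nat) (sigma : R) (xi : 'I_n -> {RV P >-> R}).
Hypotheses (sigma_gt0 : 0 < sigma) (hxi : isotropic_gaussian sigma xi).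

Lemma gaussian_mgf i t :
  (\int[P]_w (expR (t * xi i w))%:E = (expR (sigma ^+ 2 * t ^+ 2 / 2))%:E)%E.
Proof.
rewrite -gaussian_mgf_integral ?gt_eqF//.
transitivity (\int[P]_w ((cst 1 w : R) * expR (t * xi i w))%:E)%E.
  by apply: eq_integral => w _; rewrite /= mul1r.
pose f x := expR (t * x).
have mf : measurable_fun setT f.
  by apply: measurableT_comp => //; exact: measurable_funM.
apply: (@eq_weighted_law _ _ _ _ _ _ _ P lebesgue_measure
  (cst 1) (xi i) (normal_pdf 0 sigma) id f) => //.
- exact: measurable_normal_pdf.
- by move=> x; exact: normal_pdf_ge0.
- by move=> x; exact: expR_ge0.
move=> B mB.
have pE := hxi.1 i B mB; rewrite /normal_prob integral_mkcond in pE.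
transitivity (distribution P (xi i) B).
  rewrite -[RHS]/(P (xi i @^-1` B)) -[in RHS](setIT (_ @^-1` _)).
  rewrite -integral_indic//; last by rewrite -[_ @^-1` _]setTI; exact: measurable_funP.
  by apply: eq_integral => w _; rewrite /= mul1r.
rewrite pE; apply: eq_integral => x _; rewrite patchE indicE.
by case: (x \in B); rewrite /= ?mulr1// mulr0.
Qed.

Definition noise (w : T) : 'cV[R]_n := \col_i xi i w.

Lemma measurable_dot_noise (c : 'cV[R]_n) :
  measurable_fun setT (fun w => dot c (noise w)).
Proof.
apply: (@measurable_sum _ _ _ setT _ (index_enum _)
  (fun i w => c i 0 * noise w i 0)) => i.
apply: measurable_funM => //.
by rewrite (_ : (fun w => _) = xi i)//; apply/funext => w; rewrite mxE.
Qed.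

Lemma gaussian_linear_mgf (c : 'cV[R]_n) :
  (\int[P]_w (expR (dot c (noise w)))%:E =
   (expR (sigma ^+ 2 * sqnorm2 c / 2))%:E)%E.
Proof.
pose f i x := expR (c i 0 * x).
pose e i := expR (sigma ^+ 2 * c i 0 ^+ 2 / 2).
transitivity (\int[P]_w (\prod_i f i (xi i w))%:E)%E.
  apply: eq_integral => w _; rewrite /dot expR_sum.
  by congr EFin; apply: eq_bigr => i _; rewrite mxE.
rewrite (@indep_integral_prod _ _ _ _ _ _ f e hxi.2).
- by rewrite -expR_sum -mulr_suml -mulr_sumr.
- by move=> i; apply: measurableT_comp => //; exact: measurable_funM.
- by move=> i x; exact: expR_ge0.
- by move=> i; exact: gaussian_mgf.
Qed.

End gaussian_vector.

Section gaussian_quadratic.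
Context (d : measure_display) (T : measurableType d) (R : realType)
  (P : probability T R) (n : nat) (sigma : R) (xi : 'I_n -> {RV P >-> R}).
Hypotheses (sigma_gt0 : 0 < sigma) (hxi : isotropic_gaussian sigma xi).
Local Notation noise := (noise xi).

Let Q m (u : nat -> 'cV[R]_n) (c : 'cV[R]_n) w :=
  dot c (noise w) + (\sum_(b < m) dot (u b) (noise w) ^+ 2) / (4 * sigma ^+ 2).

Lemma measurable_sum_sq_dot_noise m (u : nat -> 'cV[R]_n) :
  measurable_fun setT (fun w => \sum_(b < m) dot (u b) (noise w) ^+ 2).
Proof.
apply: (@measurable_sum _ _ _ setT _ (index_enum _)
  (fun (b : 'I_m) w => dot (u b) (noise w) ^+ 2)) => b.
by apply: measurable_funX; exact: measurable_dot_noise.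
Qed.

Let measurable_expQ m u c : measurable_fun setT (fun w => expR (Q m u c w)).
Proof.
apply: measurableT_comp => //; apply: measurable_funD.
  exact: measurable_dot_noise.
by apply: measurable_funM => //; exact: measurable_sum_sq_dot_noise.
Qed.

(** Induction on [m]. The last square is linearised by averaging over a standard
normal [g], Tonelli's theorem exchanges [g] and the noise, and the induction
hypothesis applies to the shifted linear form [c + (r * g) *: u m]. This is why
the statement carries a linear term [c] orthogonal to the family. *)
Lemma gaussian_quadratic_mgf m (u : nat -> 'cV[R]_n) (c : 'cV[R]_n) :
  orthonormal_upto m u -> (forall b, (b < m)%N -> dot (u b) c = 0) ->
  (\int[P]_w (expR (dot c (noise w) +
      (\sum_(b < m) dot (u b) (noise w) ^+ 2) / (4 * sigma ^+ 2)))%:E =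
   (Num.sqrt 2 ^+ m * expR (sigma ^+ 2 * sqnorm2 c / 2))%:E)%E.
Proof.
rewrite -/(Q _ _ _ _); elim: m c => [|m IH] c ou cu.
  under eq_integral do rewrite /Q big_ord0 mul0r addr0.
  by rewrite (gaussian_linear_mgf sigma_gt0 hxi) expr0 mul1r.
have s0 : sigma != 0 by rewrite gt_eqF.
have s2_gt0 : 0 < Num.sqrt 2 :> R by rewrite sqrtr_gt0.
have s20 : Num.sqrt 2 != 0 :> R by rewrite gt_eqF.
have s2sq : Num.sqrt 2 ^+ 2 = 2 :> R by rewrite sqr_sqrtr.
(* [r] is such that [expR ((r * z) ^+ 2 / 2)] is the factor of the last square. *)
pose r := (Num.sqrt 2 * sigma)^-1.
have rE : r ^+ 2 = (2 * sigma ^+ 2)^-1 by rewrite /r exprVn exprMn s2sq.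
pose z w := dot (u m) (noise w).
pose h (wg : T * measurableTypeR R) : \bar R :=
  (expR (Q m u c wg.1) * (normal_pdf 0 1 wg.2 * expR (r * z wg.1 * wg.2)))%:E.
have mh : measurable_fun setT h.
  apply/measurable_EFinP; apply: measurable_funM.
    exact: (measurableT_comp (measurable_expQ m u c)).
  apply: measurable_funM.
    exact: (measurableT_comp (measurable_normal_pdf 0 1)).
  apply: measurableT_comp => //; apply: measurable_funM => //.
  apply: measurable_funM => //.
  exact: (measurableT_comp (measurable_dot_noise xi (u m))).
have h0 wg : (0 <= h wg)%E.
  by rewrite lee_fin !mulr_ge0// ?expR_ge0// normal_pdf_ge0.
transitivity (\int[P]_w \int[lebesgue_measure]_g h (w, g))%E.
  apply: eq_integral => w _; rewrite /h /=.
  under eq_integral do rewrite EFinM.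
  rewrite ge0_integralZl_EFin//=; last 2 first.
  - by move=> g _; rewrite lee_fin mulr_ge0// ?expR_ge0// normal_pdf_ge0.
  - apply/measurable_EFinP; apply: measurable_funM.
      exact: measurable_normal_pdf.
    by apply: measurableT_comp => //; exact: measurable_funM.
  rewrite gaussian_mgf_integral ?oner_neq0// -EFinM -expRD; congr (expR _)%:E.
  rewrite /Q big_ord_recr /= exprMn rE -/(z w) mulrDl addrA; congr (_ + _).
  by field.
rewrite fubini_tonelli//.
transitivity (\int[lebesgue_measure]_g
   ((Num.sqrt 2 ^+ m * expR (sigma ^+ 2 * sqnorm2 c / 2))%:E *
    (normal_pdf 0 1 g * expR (g ^+ 2 / 4))%:E))%E.
  apply: eq_integral => g _; rewrite /h /=.
  transitivity (\int[P]_w ((normal_pdf 0 1 g)%:E *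
                  (expR (Q m u (c + (r * g) *: u m) w))%:E))%E.
    apply: eq_integral => w _; rewrite -EFinM mulrCA -expRD; congr (_ * expR _)%:E.
    by rewrite /Q dotDl dotZl -/(z w); ring.
  rewrite ge0_integralZl_EFin//=; last 2 first.
  - by apply/measurable_EFinP; exact: measurable_expQ.
  - exact: normal_pdf_ge0.
  rewrite IH; last 2 first.
  - by move=> a b am bm; rewrite ou// ltnW.
  - move=> b bm; rewrite dotDr dotZr cu ?ltnS 1?ltnW//.
    by rewrite ou ?ltnS// 1?ltnW// ltn_eqF// mulr0 addr0.
  rewrite -!EFinM; congr EFin; rewrite mulrCA -[RHS]mulrA; congr (_ * _).
  rewrite [RHS]mulrCA -expRD; congr (_ * expR _).
  rewrite sqnorm2D sqnorm2Z dotZr (dotC c) cu// (sqnorm2E (u m)) ou// eqxx mulr1 exprMn rE.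
  by field.
rewrite ge0_integralZl_EFin//=; last 2 first.
- by move=> g _; rewrite lee_fin mulr_ge0// ?expR_ge0// normal_pdf_ge0.
- apply/measurable_EFinP; apply: measurable_funM.
    exact: measurable_normal_pdf.
  by apply: measurableT_comp => //; apply: measurable_funM => //; exact: measurable_funX.
rewrite gaussian_exp_sq_integral -EFinM; congr EFin.
by rewrite (exprSr _ m); ring.
Qed.

(** Chernoff's bound at parameter 1; other parameters are obtained by scaling [Z]. *)
Lemma exp_markov (Z : T -> R) (e a : R) :
  measurable_fun setT Z -> (\int[P]_w (expR (Z w))%:E <= e%:E)%E ->
  (P [set w | (a <= Z w)%R] <= (e * expR (- a))%:E)%E.
Proof.
move=> mZ Ze; pose X : {RV P >-> R} := HB.pack Z (isMeasurableFun.Build _ _ _ _ _ mZ).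
have := @chernoff _ _ _ P X 1 a ltr01.
rewrite mul1r => /le_trans; apply.
rewrite EFinM lee_wpmul2r ?lee_fin ?expR_ge0//.
rewrite /mmt_gen_fun unlock; apply: le_trans Ze.
by under eq_integral do rewrite /= mulr1.
Qed.

End gaussian_quadratic.

(** * Tail bounds *)

Section measurable_superlevel.
Context d (T : measurableType d) (R : realType) (f : T -> R) (a : R).
Hypothesis mf : measurable_fun setT f.

Lemma measurable_ge_set : measurable [set w | a <= f w].
Proof.
by rewrite -[X in measurable X]setTI; exact: measurable_fun_le.
Qed.

Lemma measurable_le_set : measurable [set w | f w <= a].
Proof.
by rewrite -[X in measurable X]setTI; exact: measurable_fun_le.
Qed.

Lemma measurable_gt_set : measurable [set w | a < f w].
Proof.
have -> : [set w | a < f w] = ~` [set w | f w <= a].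
  by apply/seteqP; split => w /=; rewrite ltNge => /negP.
exact: measurableC measurable_le_set.
Qed.

End measurable_superlevel.

Section gaussian_tails.
Context (d : measure_display) (T : measurableType d) (R : realType)
  (P : probability T R) (n : nat) (sigma : R) (xi : 'I_n -> {RV P >-> R}).
Hypotheses (sigma_gt0 : 0 < sigma) (hxi : isotropic_gaussian sigma xi).

(** Chernoff's bound with exponent [1/4]: each degree of freedom costs a factor
[sqrt 2], which is at most [expR (1/2)] and so is paid for by the term
[2 * m%:R] of the threshold. *)
Lemma chi_square_tail m (u : nat -> 'cV[R]_n) (x : R) : orthonormal_upto m u ->
  (P [set w | (sigma ^+ 2 * (2 * m%:R + 4 * x)
               <= \sum_(b < m) dot (u b) (noise xi w) ^+ 2)%R]
   <= (expR (- x))%:E)%E.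
Proof.
move=> ou.
pose Z w := dot 0 (noise xi w) +
  (\sum_(b < m) dot (u b) (noise xi w) ^+ 2) / (4 * sigma ^+ 2).
have mZ : measurable_fun setT Z.
  apply: measurable_funD; first exact: measurable_dot_noise.
  by apply: measurable_funM => //; exact: measurable_sum_sq_dot_noise.
have := gaussian_quadratic_mgf sigma_gt0 hxi ou (fun b _ => dot0r (u b)).
rewrite sqnorm2E dot0r mulr0 mul0r expR0 mulr1 => mgf.
have {}mgf : (\int[P]_w (expR (Z w))%:E <= (Num.sqrt 2 ^+ m)%:E)%E by rewrite mgf.
have := exp_markov (m%:R / 2 + x) mZ mgf.
suff -> : [set w | m%:R / 2 + x <= Z w] = [set w |
    sigma ^+ 2 * (2 * m%:R + 4 * x) <= \sum_(b < m) dot (u b) (noise xi w) ^+ 2].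
  move=> /le_trans; apply; rewrite lee_fin opprD expRD mulrA ler_piMl ?expR_ge0//.
  have -> : - (m%:R / 2) = m%:R * (- 2^-1) :> R by field.
  rewrite expRM_natl -exprMn exprn_ile1 ?mulr_ge0 ?expR_ge0 ?sqrtr_ge0//.
  have s2e : Num.sqrt 2 <= expR 2^-1 :> R.
    rewrite -(@ler_pXn2r _ 2)// ?nnegrE ?sqrtr_ge0 ?expR_ge0// sqr_sqrtr//.
    rewrite -expRM_natl; have -> : 2 * 2^-1 = 1 :> R by field.
    by have := @expR_ge1Dx R 1; lra.
  rewrite expRN ler_pdivrMr ?expR_gt0// mul1r; exact: s2e.
apply/funext => w; rewrite /Z /= dotC dot0r add0r; apply/propext.
rewrite ler_pdivlMr ?mulr_gt0 ?exprn_gt0//.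
by have -> : (m%:R / 2 + x) * (4 * sigma ^+ 2) =
  sigma ^+ 2 * (2 * m%:R + 4 * x) by field.
Qed.

(** A bound [v] on [sqnorm2 a] instead of its value lets many vectors share one
exponent. *)
Lemma gaussian_upper_tail (a : 'cV[R]_n) (v t : R) :
  0 < v -> sqnorm2 a <= v -> 0 < t ->
  (P [set w | (t <= dot a (noise xi w))%R]
   <= (expR (- (t ^+ 2 / (2 * sigma ^+ 2 * v))))%:E)%E.
Proof.
move=> v0 av t0.
have s0 : sigma != 0 by rewrite gt_eqF.
(* The minimiser of the Chernoff exponent. *)
pose s := t / (sigma ^+ 2 * v).
have s_gt0 : 0 < s by rewrite divr_gt0// mulr_gt0// exprn_gt0.
have mgf : (\int[P]_w (expR (dot (s *: a) (noise xi w)))%:E <=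
    (expR (sigma ^+ 2 * s ^+ 2 * v / 2))%:E)%E.
  rewrite (gaussian_linear_mgf sigma_gt0 hxi) lee_fin ler_expR sqnorm2Z.
  by rewrite ler_pM2r ?invr_gt0// -mulrA ler_pM2l ?exprn_gt0// ler_pM2l ?exprn_gt0.
have := exp_markov (s * t) (measurable_dot_noise xi (s *: a)) mgf.
suff -> : [set w | s * t <= dot (s *: a) (noise xi w)] =
          [set w | t <= dot a (noise xi w)].
  move=> /le_trans; apply; rewrite lee_fin -expRD ler_expR le_eqVlt; apply/orP.
  by left; apply/eqP; rewrite /s; field; rewrite s0 gt_eqF.
apply/funext => w; rewrite /= dotZl; apply/propext.
by rewrite ler_pM2l.
Qed.

Lemma gaussian_two_sided_tail (a : 'cV[R]_n) (v t : R) :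
  0 < v -> sqnorm2 a <= v -> 0 < t ->
  (P [set w | (t < `|dot a (noise xi w)|)%R]
   <= (2 * expR (- (t ^+ 2 / (2 * sigma ^+ 2 * v))))%:E)%E.
Proof.
move=> v0 av t0.
have mS (c : 'cV[R]_n) : measurable [set w | t <= dot c (noise xi w)].
  exact/measurable_ge_set/measurable_dot_noise.
have mA : measurable [set w | t < `|dot a (noise xi w)|].
  apply: measurable_gt_set.
  by apply: measurableT_comp => //; exact: measurable_dot_noise.
apply: (@le_trans _ _ (P ([set w | (t <= dot a (noise xi w))%R] `|`
                          [set w | (t <= dot (- a) (noise xi w))%R]))).
  rewrite le_measure ?inE//; first exact: measurableU.
  move=> w /=; rewrite (dotC (- a)) dotNr (dotC _ a); case: (leP 0 (dot a (noise xi w))) => h.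
    by rewrite ger0_norm// => /ltW; left.
  by rewrite ltr0_norm// => /ltW; right.
apply: (le_trans (measureU2 _ _ _)) => //.
rewrite mulr_natl mulr2n EFinD.
apply: leeD; apply: gaussian_upper_tail => //.
by rewrite -scaleN1r sqnorm2Z sqrrN expr1n mul1r.
Qed.

End gaussian_tails.

(** * Total variation and the estimator *)

Section total_variation.
Context (R : realType) (n : nat).
Implicit Types f g z : 'cV[R]_n.

(** The increments whose absolute values [TV] adds up. *)
Definition incr f (i : 'I_n) : R :=
  f i 0 - (if val i == 0%N then 0 else f (ord_pred i) 0).

(** The column of index [j] of the design matrix of the lasso formulation. *)
Definition step (j : nat) : 'cV[R]_n := \col_i (j <= i)%N%:R.

Lemma incrD f g i : incr (f + g) i = incr f i + incr g i.
Proof. by rewrite /incr !mxE; case: ifP => _; ring. Qed.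

Lemma incrZ a f i : incr (a *: f) i = a * incr f i.
Proof. by rewrite /incr !mxE; case: ifP => _; ring. Qed.

Lemma TV_ge0 f : 0 <= TV f.
Proof. by apply: sumr_ge0. Qed.

Lemma TVD f g : TV (f + g) <= TV f + TV g.
Proof.
rewrite /TV -big_split; apply: ler_sum => i _.
by rewrite -!/(incr _ _) incrD ler_normD.
Qed.

Lemma TVZ a f : TV (a *: f) = `|a| * TV f.
Proof.
rewrite /TV mulr_sumr; apply: eq_bigr => i _.
by rewrite -!/(incr _ _) incrZ normrM.
Qed.

Lemma TVB f g : TV (f - g) <= TV f + TV g.
Proof. by rewrite -scaleN1r (le_trans (TVD _ _))// TVZ normrN1 mul1r. Qed.

Lemma sum_incr f i : f i 0 = \sum_(j < n | (j <= i)%N) incr f j.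
Proof.
case: i => k; elim: k => [|k IH] kn /=.
  rewrite (big_pred1 (Ordinal kn)); last first.
    by move=> j; rewrite leqn0.
  by rewrite /incr /= subr0.
rewrite (bigD1 (Ordinal kn))//=.
rewrite (eq_bigl (fun j : 'I_n => (j <= k)%N)); last first.
  by move=> j; rewrite -(inj_eq val_inj) /= andbC -ltn_neqAle.
have kn' : (k < n)%N by exact: ltnW.
rewrite -(IH kn') /incr /=.
have -> : ord_pred (Ordinal kn) = Ordinal kn'.
  by apply/val_inj => /=; rewrite modnDr modn_small.
by rewrite subrK.
Qed.

(** Abel summation: [f] is the combination of the steps with its increments as
coefficients. *)
Lemma dot_incr z f : dot z f = \sum_(j < n) incr f j * dot z (step j).
Proof.
transitivity (\sum_(j < n) \sum_(i < n) incr f j * (z i 0 * step j i 0)); last first.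
  by apply: eq_bigr => j _; rewrite /dot mulr_sumr.
rewrite exchange_big /=; apply: eq_bigr => i _.
rewrite (sum_incr f) mulr_sumr big_mkcond; apply: eq_bigr => j _.
by rewrite mxE; case: (j <= i)%N => /=; ring.
Qed.

Lemma dot_le_TV z f M : (forall j : 'I_n, `|dot z (step j)| <= M) ->
  dot z f <= M * TV f.
Proof.
move=> zM; rewrite dot_incr mulr_sumr; apply: ler_sum => j _.
rewrite -/(incr f j) (le_trans (ler_norm _))// normrM mulrC.
by rewrite ler_wpM2r.
Qed.

End total_variation.

Arguments step {R n} j.

Section estimator.
Context (R : realType) (n : nat) (lambda : R).
Hypotheses (n_gt0 : (0 < n)%N) (lambda_ge0 : 0 <= lambda).
Implicit Types f g y : 'cV[R]_n.

(** Compare the minimiser [f] with [f + t *: (g - f)] for small [t > 0]: by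
convexity of TV the first-order terms in [t] have the asserted sign, up to an
error [t * B] that vanishes with [t]. *)
Lemma TV_estimator_variational y f g : TV_estimator lambda y f ->
  dot (y - f) (g - f) <= n%:R * lambda * (TV g - TV f).
Proof.
move=> [_ fmin].
have n0 : 0 < n%:R :> R by rewrite ltr0n.
set A := dot _ _; set B := sqnorm2 (g - f).
have B0 : 0 <= B by exact: sqnorm2_ge0.
have key t : 0 < t < 1 -> 2 * (A - n%:R * lambda * (TV g - TV f)) <= t * B.
  move=> /andP[t0 t1].
  have := fmin (f + t *: (g - f)) Logic.I.
  have -> : sqnorm2 (y - (f + t *: (g - f))) =
      sqnorm2 (y - f) - 2 * t * A + t ^+ 2 * B.
    by rewrite opprD addrA (sqnorm2B (y - f)) dotZr sqnorm2Z -/A -/B; ring.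
  have TVle : lambda * TV (f + t *: (g - f)) <=
      lambda * ((1 - t) * TV f + t * TV g).
    apply: ler_wpM2l => //.
    have -> : f + t *: (g - f) = (1 - t) *: f + t *: g.
      by apply/matrixP => i j; rewrite !mxE; ring.
    by rewrite (le_trans (TVD _ _))// !TVZ !ger0_norm// ?subr_ge0 ltW.
  move=> opt.
  have {opt}opt : (2 * n%:R)^-1 * (2 * t * A - t ^+ 2 * B) <=
      lambda * (t * (TV g - TV f)).
    by move: opt TVle; rewrite !mulrDr; lra.
  rewrite ler_pdivrMl ?mulr_gt0// in opt.
  rewrite -(ler_pM2l t0).
  by move: opt; rewrite expr2; lra.
rewrite -subr_le0 leNgt; apply/negP => C0.
set C := A - _ in key C0.
have D0 : 0 < C + B + 1 by rewrite ltr_wpDr// ltr_pwDl.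
(* A value of [t] in the unit interval for which [t * B < C]. *)
have := key (C / (C + B + 1)).
have -> : 0 < C / (C + B + 1) < 1.
  by rewrite divr_gt0//= ltr_pdivrMr// mul1r; lra.
by move=> /(_ isT); rewrite mulrAC ler_pdivlMr//; nra.
Qed.

(** The estimator is a proximal map: adding the variational inequalities of [f1]
tested at [f2] and of [f2] tested at [f1] eliminates the penalties. *)
Lemma TV_estimator_nonexpansive y1 y2 f1 f2 :
  TV_estimator lambda y1 f1 -> TV_estimator lambda y2 f2 ->
  sqnorm2 (f1 - f2) <= sqnorm2 (y1 - y2).
Proof.
move=> h1 h2.
have := TV_estimator_variational f2 h1; have := TV_estimator_variational f1 h2.
have : 0 <= sqnorm2 ((y1 - y2) - (f1 - f2)) by exact: sqnorm2_ge0.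
rewrite sqnorm2B.
have e : dot (y1 - y2) (f1 - f2) - sqnorm2 (f1 - f2) =
    - dot (y1 - f1) (f2 - f1) - dot (y2 - f2) (f1 - f2).
  rewrite sqnorm2E !(dotBl, dotBr); ring.
lra.
Qed.

(** Holds for every comparison vector [g]. The quadratic part of Young's
inequality is exactly compensated by the term [sqnorm2 (f - g)] gained from
strong convexity, whence the leading constant 1. *)
Lemma TV_estimator_oracle (fstar noise f g : 'cV[R]_n) d (u : nat -> 'cV[R]_n) :
  orthonormal_upto d u ->
  TV_estimator lambda (fstar + noise) f ->
  (forall j : 'I_n, `|dot (step j - proj d u (step j)) noise| <= n%:R * lambda) ->
  sqnorm2 (f - fstar) <= sqnorm2 (g - fstar) + 4 * (n%:R * lambda * TV g)
    + \sum_(b < d) dot (u b) noise ^+ 2.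
Proof.
move=> ou hf hnoise.
set mu := n%:R * lambda.
have mu0 : 0 <= mu by rewrite mulr_ge0.
have var := TV_estimator_variational g hf.
set h := f - g.
have residual : dot (noise - proj d u noise) h <= mu * (TV f + TV g).
  apply: (@le_trans _ _ (mu * TV h)); last by rewrite ler_wpM2l// TVB.
  by apply: dot_le_TV => j; rewrite dotC proj_residual_adjoint.
have bessel : \sum_(b < d) dot (u b) h ^+ 2 <= sqnorm2 h.
  by rewrite -subr_ge0 -(sqnorm2_proj_residual ou) sqnorm2_ge0.
have young : 2 * dot h (proj d u noise) <=
    \sum_(b < d) dot (u b) noise ^+ 2 + \sum_(b < d) dot (u b) h ^+ 2.
  rewrite dot_proj mulr_sumr -big_split; apply: ler_sum => b _ /=.
  by rewrite -subr_ge0; have := sqr_ge0 (dot (u b) noise - dot (u b) h); nra.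
have split_noise : dot noise h = dot (noise - proj d u noise) h + dot h (proj d u noise).
  by rewrite dotBl (dotC h) subrK.
have expand : sqnorm2 (f - fstar) = sqnorm2 (g - fstar)
    - 2 * dot (fstar + noise - f) h + 2 * dot noise h - sqnorm2 h.
  rewrite !sqnorm2E /h !(dotBl, dotBr, dotDl, dotDr).
  by rewrite (dotC g f) (dotC fstar f) (dotC fstar g); ring.
have varE : dot (fstar + noise - f) h = - dot (fstar + noise - f) (g - f).
  by rewrite -dotNr opprB.
move: var; rewrite -/mu; lra.
Qed.

End estimator.

(** * Piecewise constant vectors on blocks *)

(** From [4 * (c * (s - c)) <= s ^ 2] one gets the factor [3 * m / 4], which is at
most [m - 1] from [m = 4] on. For [m = 3] the bound is saved by integrality. *)
Lemma split_long_block_le (m s c : nat) :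
  (3 <= m)%N -> (s <= m)%N -> (c <= s)%N ->
  (3 * (c * (s - c)) <= s * m.-1)%N.
Proof.
move=> m3 sm cs; have [m4|m_le3] := leqP 4 m.
  have : (4 * (c * (s - c)) <= s ^ 2)%N.
    by rewrite -[in leqRHS](subnKC cs) nat_AGM2.
  have : (4 * (s * m.-1) >= 3 * (s * s))%N by nia.
  by rewrite expnS expn1; lia.
have {m_le3}m3E : m = 3%N by lia.
by subst m; case: s sm cs => [|[|[|[|s]]]]//= _; case: c => [|[|[|[|c]]]].
Qed.

Section blocks.
Context (R : realType) (n m : nat).
Hypotheses (n_gt0 : (0 < n)%N) (m_gt0 : (0 < m)%N).

Definition block_size (b : nat) : nat := \sum_(i < n) (i %/ m == b)%N.

Definition block_tail (j b : nat) : nat := \sum_(i < n) ((i %/ m == b) && (j <= i))%N.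

Definition block_vec (b : nat) : 'cV[R]_n :=
  \col_i ((i %/ m == b)%N%:R / Num.sqrt (block_size b)%:R).

Definition block_count : nat := (n.-1 %/ m).+1.

Lemma block_lt_count (i : 'I_n) : (i %/ m < block_count)%N.
Proof. by rewrite ltnS leq_div2r// -ltnS prednK. Qed.

Lemma block_size_le b : (block_size b <= m)%N.
Proof.
have -> : block_size b = #|[pred i : 'I_n | i %/ m == b]%N|.
  by rewrite /block_size -sum1_card [RHS]big_mkcond /=; apply: eq_bigr => i _;
    rewrite inE; case: (_ == b).
pose r (i : 'I_n) : 'I_m := Ordinal (ltn_pmod i m_gt0).
rewrite -(card_in_imset (f := r)).
  by rewrite -[leqRHS]card_ord max_card.
move=> i i' /eqP ib /eqP i'b /(congr1 val) /= ii'.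
by apply: val_inj; rewrite /= (divn_eq i m) (divn_eq i' m) ib i'b ii'.
Qed.

Lemma block_size_gt0 b : (b < block_count)%N -> (0 < block_size b)%N.
Proof.
rewrite ltnS => bD.
have bm : (b * m < n)%N.
  rewrite -(prednK n_gt0) ltnS (leq_trans _ (leq_trunc_div n.-1 m))//.
  by rewrite leq_mul2r bD orbT.
rewrite /block_size (bigD1 (Ordinal bm))//= addn_gt0.
by rewrite mulnK// eqxx.
Qed.

Lemma block_tail_le j b : (block_tail j b <= block_size b)%N.
Proof. by apply: leq_sum => i _; case: (_ == b) => //=; exact: leq_b1. Qed.

(** A step is constant on every block but the one containing its jump. *)
Lemma block_tail_other j b : b != (j %/ m)%N ->
  (block_tail j b * (block_size b - block_tail j b) = 0)%N.
Proof.
move=> bj; case: (ltngtP b (j %/ m)) bj => // bj _.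
  rewrite (_ : block_tail j b = 0%N)//.
  rewrite /block_tail big1// => i _; apply/eqP; rewrite eqb0.
  apply/negP => /andP[/eqP ib ji].
  by move: bj; rewrite -ib ltnNge leq_div2r.
rewrite (_ : block_tail j b = block_size b) ?subnn ?muln0//.
apply: eq_bigr => i _; case: eqP => //= ib.
by rewrite leqNgt; case: ltnP => // ij; move: bj; rewrite -ib ltnNge leq_div2r// ltnW.
Qed.

Lemma block_vec_orthonormal : orthonormal_upto block_count block_vec.
Proof.
move=> a b aD bD; rewrite /dot.
under eq_bigr do rewrite !mxE.
have [->|ab] := eqVneq a b.
  have s0 : 0 < (block_size b)%:R :> R by rewrite ltr0n block_size_gt0.
  rewrite (eq_bigr (fun i : 'I_n => (i %/ m == b)%N%:R / (block_size b)%:R)).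
    by rewrite -mulr_suml -natr_sum -/(block_size b) divff ?gt_eqF.
  move=> i _; rewrite mulrACA -invfM -(expr2 (Num.sqrt _)) sqr_sqrtr ?ltW//.
  by case: eqP => _; rewrite ?mul0r ?mulr1.
rewrite big1// => i _; have [->|ia] := eqVneq (i %/ m)%N a.
  by rewrite (negbTE ab) !mul0r mulr0.
by rewrite !mul0r.
Qed.

(** Within the block of its jump a step takes the values 0 and 1, with [s - c] and
[c] entries, and the residual is its deviation from the mean; elsewhere it is
reproduced by the projection. *)
Lemma block_residual (j : 'I_n) :
  let c := block_tail j (j %/ m) in let s := block_size (j %/ m) in
  sqnorm2 (step j - proj block_count block_vec (step j)) =
  (c * (s - c))%N%:R / s%:R.
Proof.
move=> c s; rewrite sqnorm2_proj_residual; last exact: block_vec_orthonormal.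
have tailE b :
    dot (block_vec b) (step j) = (block_tail j b)%:R / Num.sqrt (block_size b)%:R.
  rewrite /block_tail natr_sum mulr_suml; apply: eq_bigr => i _.
  by rewrite !mxE; case: eqP => _; case: leqP => _; rewrite /= ?mulr1 ?mulr0 ?mul0r.
have normE : sqnorm2 (step j : 'cV[R]_n) = \sum_(b < block_count) (block_tail j b)%:R.
  under [RHS]eq_bigr do rewrite natr_sum.
  rewrite exchange_big; apply: eq_bigr => i _ /=.
  rewrite (bigD1 (Ordinal (block_lt_count i)))//= eqxx big1 ?addr0.
    by rewrite mxE; case: leqP => _; rewrite ?expr1n ?expr0n.
  by move=> b bi; rewrite [X in (X && _)%N](_ : _ = false)//;
    apply/negbTE; rewrite eq_sym.
rewrite normE -sumrB (bigD1 (Ordinal (block_lt_count j)))//= big1 ?addr0.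
  rewrite tailE expr_div_n sqr_sqrtr ?ler0n// -/c -/s natrM natrB ?block_tail_le//.
  by field; rewrite pnatr_eq0 -lt0n block_size_gt0// block_lt_count.
move=> b; rewrite -(inj_eq val_inj) /= => bj.
have s0 : (0 < block_size b)%N by exact: block_size_gt0.
have /eqP := block_tail_other bj; rewrite -(eqr_nat R) natrM natrB ?block_tail_le//.
rewrite tailE expr_div_n sqr_sqrtr ?ler0n// => /eqP t0.
apply: (@mulIf _ (block_size b)%:R); first by rewrite pnatr_eq0 -lt0n.
rewrite mul0r mulrBl divfK ?pnatr_eq0 -?lt0n//.
by move: t0; rewrite mulr0n => t0; rewrite -[RHS]t0; ring.
Qed.

End blocks.

Lemma sum_odd_lt n : (\sum_(j < n) odd j = n./2)%N.
Proof.
elim: n => [|n IH]; first by rewrite big_ord0.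
by rewrite big_ord_recr IH /= uphalf_half addnC.
Qed.

Section residual_bounds.
Context (R : realType) (n m : nat).
Hypotheses (n_gt0 : (0 < n)%N) (m_gt0 : (0 < m)%N).
Local Notation res j :=
  (step j - proj (block_count n m) (block_vec R n m) (step j)).

(** A step that jumps at the start of a block is constant on all blocks. *)
Lemma residual_multiple (j : 'I_n) : (m %| j)%N -> res j = 0.
Proof.
move=> mj; have tail_full : block_tail n m j (j %/ m) = block_size n m (j %/ m).
  apply: eq_bigr => i _; case: eqP => //= ij.
  by rewrite -(divnK mj) -ij leq_trunc_div.
have := block_residual R n_gt0 m_gt0 j; rewrite /= tail_full subnn muln0 mul0r.
move=> /eqP; rewrite psumr_eq0; last by move=> i _; exact: sqr_ge0.
move=> /allP r0; apply/matrixP => i k; rewrite (ord1 k) [RHS]mxE.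
by have := r0 i (mem_index_enum i); rewrite sqrf_eq0 => /eqP.
Qed.

Let size_gt0 (j : 'I_n) : (0 < block_size n m (j %/ m))%N.
Proof. by apply: block_size_gt0 => //; exact: block_lt_count. Qed.

Lemma residual_pairs (j : 'I_n) : m = 2%N -> sqnorm2 (res j) <= 2^-1.
Proof.
move=> m2; rewrite block_residual//= ler_pdivrMr ?ltr0n// ler_pdivlMl//.
rewrite -natrM ler_nat.
have := block_tail_le n m j (j %/ m); have := block_size_le n m_gt0 (j %/ m).
move: (block_tail _ _ _ _) (block_size _ _ _) (size_gt0 j) => c s s0.
rewrite m2; case: s s0 => [|[|[|s]]]// _ _; by case: c => [|[|[|c]]].
Qed.

Lemma residual_long_blocks (j : 'I_n) k : (3 <= m)%N -> (0 < k)%N ->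
  (m.-1 * k < n)%N -> sqnorm2 (res j) <= n%:R / (3 * k%:R).
Proof.
move=> m3 k0 mkn; rewrite block_residual//= ler_pdivrMr ?ltr0n// mulrAC.
rewrite ler_pdivlMr ?mulr_gt0 ?ltr0n// -!natrM ler_nat.
have := split_long_block_le m3 (block_size_le n m_gt0 (j %/ m))
  (block_tail_le n m j (j %/ m)).
set x := (_ * (_ - _))%N; set s := block_size _ _ _ => h.
rewrite mulnCA mulnA (leq_trans (leq_mul h (leqnn k)))//.
by rewrite -mulnA mulnC leq_mul2r (ltnW mkn) orbT.
Qed.

End residual_bounds.

(** * Measurability of the estimator *)

(** Measurability of a continuous function of finitely many random variables: a
superlevel set is the union of the rational boxes, in the coordinates [X],
that it contains. The function is given on the sample space only, hence
continuity is expressed through [X]. *)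
Lemma measurable_fun_of_coordinates d (T : measurableType d) (R : realType) n
    (X : 'I_n -> T -> R) (phi : T -> R) :
  (forall i, measurable_fun setT (X i)) ->
  (forall w0 e, 0 < e -> exists2 r, 0 < r &
     forall w, (forall i, `|X i w - X i w0| < r) -> `|phi w - phi w0| < e) ->
  measurable_fun setT phi.
Proof.
move=> mX cphi.
pose box (q : {ffun 'I_n -> rat}) (r : rat) : set T :=
  \bigcap_(i in [set: 'I_n]) [set w | `|X i w - ratr (q i)| < ratr r].
have mbox q r : measurable (box q r).
  apply: fin_bigcap_measurable; first exact: finite_finset.
  move=> i _; rewrite (_ : [set _ | _] = ~` [set w | ratr r <= `|X i w - ratr (q i)|]).
    apply/measurableC/measurable_ge_set/measurableT_comp => //.
    exact: measurable_funB.
  by apply/seteqP; split => w /=; rewrite ltNge => /negP.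
move=> mT; apply: (measurability _ (RGenOInfty.measurableE R)) => //.
move=> /= _ [_ [a ->] <-]; rewrite setTI.
pose F (p : {ffun 'I_n -> rat} * rat) : set T :=
  if `[< box p.1 p.2 `<=` phi @^-1` `]a, +oo[ >] then box p.1 p.2 else set0.
have -> : phi @^-1` `]a, +oo[ = \bigcup_p F p.
  apply/seteqP; split => [w0|w [p _]]; last first.
    by rewrite /F; case: asboolP => // sub /sub.
  rewrite /= in_itv /= andbT => aw0.
  have gap0 : 0 < phi w0 - a by rewrite subr_gt0.
  have [r r0 near_phi] := cphi w0 _ gap0.
  have r20 : 0 < r / 2 by rewrite divr_gt0.
  have [rho] := rat_in_itvoo r20.
  rewrite in_itv /= => /andP[rho0 rho_r].
  have /choice[q qX] : forall i, exists q : rat, `|X i w0 - ratr q| < ratr rho.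
    move=> i; have : X i w0 - ratr rho < X i w0 + ratr rho by lra.
    move=> /rat_in_itvoo[q].
    by rewrite in_itv /= => /andP[q1 q2]; exists q; rewrite ltr_norml; lra.
  have w0box : box [ffun i => q i] rho w0 by move=> i _ /=; rewrite ffunE.
  exists ([ffun i => q i], rho) => //; rewrite /F asboolT//=.
  move=> w wbox; rewrite /= in_itv /= andbT.
  have : `|phi w - phi w0| < phi w0 - a.
    apply: near_phi => i; have := wbox i Logic.I; rewrite /= ffunE => wi.
    have := qX i; move: wi; rewrite !ltr_norml; lra.
  by rewrite ltr_norml; lra.
apply: countable_bigcupT_measurable; first exact: countableP.
by move=> p; rewrite /F; case: asboolP.
Qed.

Section estimator_measurable.
Context (d : measure_display) (T : measurableType d) (R : realType)
  (P : probability T R) (n : nat) (xi : 'I_n -> {RV P >-> R}) (lambda : R)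
  (fstar : 'cV[R]_n) (fhat : T -> 'cV[R]_n).
Hypotheses (n_gt0 : (0 < n)%N) (lambda_ge0 : 0 <= lambda).
Hypothesis hfhat : forall w, TV_estimator lambda (fstar + noise xi w) (fhat w).

Lemma sqr_le_sqnorm2 (u : 'cV[R]_n) i : u i 0 ^+ 2 <= sqnorm2 u.
Proof. by rewrite /sqnorm2 (bigD1 i)//= lerDl sumr_ge0// => j _; exact: sqr_ge0. Qed.

Lemma measurable_TV_estimator i : measurable_fun setT (fun w => fhat w i 0).
Proof.
apply: (@measurable_fun_of_coordinates _ _ _ _ (fun i w => xi i w)) => // w0 e e0.
have n0 : 0 < n%:R :> R by rewrite ltr0n.
have n1 : 1 <= n%:R :> R by rewrite ler1n.
have r0 : 0 < e / (2 * n%:R) by rewrite divr_gt0// mulr_gt0.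
exists (e / (2 * n%:R)) => // w close.
rewrite -(@ltr_pXn2r _ 2)// ?nnegrE ?normr_ge0 ?(ltW e0)// real_normK ?num_real//.
have -> : fhat w i 0 - fhat w0 i 0 = (fhat w - fhat w0) i 0 by rewrite !mxE.
apply: le_lt_trans (sqr_le_sqnorm2 _ _) _.
apply: le_lt_trans (TV_estimator_nonexpansive n_gt0 lambda_ge0 (hfhat w) (hfhat w0)) _.
have {close}le_r : sqnorm2 (fstar + noise xi w - (fstar + noise xi w0)) <=
    \sum_(i < n) (e / (2 * n%:R)) ^+ 2.
  apply: ler_sum => j _.
  have -> : (fstar + noise xi w - (fstar + noise xi w0)) j 0 = xi j w - xi j w0.
    by rewrite !mxE; ring.
  rewrite -[X in X <= _]real_normK ?num_real//.
  by rewrite ler_pXn2r// ?nnegrE ?normr_ge0 ?(ltW r0)// ltW.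
apply: le_lt_trans le_r _.
rewrite sumr_const card_ord -[X in X < _]mulr_natr expr_div_n mulrAC.
rewrite ltr_pdivrMr ?exprn_gt0 ?mulr_gt0//.
rewrite ltr_pM2l ?exprn_gt0// exprMn; nra.
Qed.

Lemma measurable_loss : measurable_fun setT (fun w => sqnorm2 (fhat w - fstar)).
Proof.
apply: (@measurable_sum _ _ _ setT _ (index_enum _)
  (fun i w => (fhat w - fstar) i 0 ^+ 2)) => i.
apply: measurable_funX.
rewrite (_ : (fun w => _) = (fun w => fhat w i 0 - fstar i 0)); last first.
  by apply/funext => w; rewrite !mxE.
by apply: measurable_funB => //; exact: measurable_TV_estimator.
Qed.

End estimator_measurable.

(** * The event on which the noise is controlled *)

Section noise_event.
Context (d : measure_display) (T : measurableType d) (R : realType)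
  (P : probability T R) (n : nat) (sigma : R) (xi : 'I_n -> {RV P >-> R})
  (delta : R) (k : nat) (lambda : R).
Hypotheses (n_gt0 : (0 < n)%N) (sigma_gt0 : 0 < sigma)
  (hxi : isotropic_gaussian sigma xi).
Hypotheses (delta_gt0 : 0 < delta) (delta_small : 4 * delta <= n%:R) (k_gt0 : (0 < k)%N).
Hypothesis lambdaE : lambda = sigma * Num.sqrt (ln (n%:R / delta) / (k%:R * n%:R)).

Local Notation L := (ln (n%:R / delta)).
Local Notation m := (n.-1 %/ k).+1.
Local Notation res j :=
  (step j - proj (block_count n m) (block_vec R n m) (step j)).

Let n0 : 0 < n%:R :> R. Proof. by rewrite ltr0n. Qed.
Let k0 : 0 < k%:R :> R. Proof. by rewrite ltr0n. Qed.

Let L_gt0 : 0 < L.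
Proof. by apply: ln_gt0; rewrite ltr_pdivlMr// mul1r; move: delta_gt0 delta_small; lra. Qed.

Let expNL : expR (- L) = delta / n%:R.
Proof. by rewrite expRN lnK ?invf_div// posrE divr_gt0. Qed.

Lemma block_length_bounds : (m.-1 * k < n)%N /\ (block_count n m <= k)%N.
Proof.
have n1 : (n.-1 < n)%N by rewrite prednK.
split; first exact: leq_ltn_trans (leq_trunc_div _ _) n1.
by rewrite /block_count ltn_divLR// mulnC ltn_ceil.
Qed.

Lemma penalty_gt0 : 0 < lambda.
Proof. by rewrite lambdaE mulr_gt0// sqrtr_gt0 divr_gt0// mulr_gt0. Qed.

Let threshold_sqr : (n%:R * lambda) ^+ 2 = sigma ^+ 2 * L * n%:R / k%:R.
Proof.
rewrite lambdaE !exprMn sqr_sqrtr; last by rewrite ltW// divr_gt0// mulr_gt0.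
by field; rewrite !gt_eqF.
Qed.

(** The share of the probability [delta] given to the index [j] in the union bound.
For blocks of length 2 the odd indices, at most half of the total, get twice
the mean share and the even ones nothing. *)
Definition bad_prob (j : nat) : R :=
  if (m %| j)%N then 0 else if m == 2%N then 2 * (delta / n%:R) else delta / n%:R.

(** With [L = ln (n / delta)], the threshold [n * lambda] has square
[sigma^2 n L / k]. Blocks of length 2 occur only for [k < n], so their squared
residual 1/2 is at most [n / (2 k)] and the tail is [2 exp (- L)]. Longer blocks
have squared residual at most [n / (3 k)], and the tail [2 exp (- 3 L / 2)] is
at most [exp (- L)] because [n / delta] is at least 4. *)
Lemma residual_tail (j : 'I_n) :
  (P [set w | (n%:R * lambda < `|dot (res j) (noise xi w)|)%R] <= (bad_prob j)%:E)%E.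
Proof.
have [mk _] := block_length_bounds.
have t0 : 0 < n%:R * lambda by rewrite mulr_gt0// penalty_gt0.
rewrite /bad_prob; case: ifPn => [mj|mj].
  rewrite residual_multiple//.
  rewrite (_ : [set _ | _] = set0) ?measure0//.
  apply/seteqP; split => w //=.
  by rewrite dotC dot0r normr0 ltNge (ltW t0).
have m_neq1 : m != 1%N by apply: contraNneq mj => ->; exact: dvd1n.
case: ifPn => m2.
  have v0 : 0 < n%:R / (2 * k%:R) :> R by rewrite divr_gt0// mulr_gt0.
  have resv : sqnorm2 (res j) <= n%:R / (2 * k%:R).
    have pairs := @residual_pairs R n m n_gt0 (ltn0Sn _) j (eqP m2).
    apply: le_trans pairs _.
    rewrite ler_pdivlMr ?mulr_gt0// mulKf// ler_nat ltnW//.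
    by move: mk; rewrite (eqP m2) mul1n.
  apply: le_trans (gaussian_two_sided_tail sigma_gt0 hxi v0 resv t0) _.
  rewrite lee_fin threshold_sqr -expNL ler_pM2l// ler_expR lerN2 le_eqVlt.
  by apply/orP; left; apply/eqP; field; rewrite !gt_eqF.
have m3 : (3 <= m)%N by move: m_neq1 m2; case: (n.-1 %/ k)%N => [|[|]].
have v0 : 0 < n%:R / (3 * k%:R) :> R by rewrite divr_gt0// mulr_gt0.
have resv : sqnorm2 (res j) <= n%:R / (3 * k%:R) by exact: residual_long_blocks.
apply: le_trans (gaussian_two_sided_tail sigma_gt0 hxi v0 resv t0) _.
rewrite lee_fin threshold_sqr.
have -> : - (sigma ^+ 2 * L * n%:R / k%:R / (2 * sigma ^+ 2 * (n%:R / (3 * k%:R))))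
    = - L + - (2^-1 * L) by field; rewrite !gt_eqF.
rewrite expRD expNL mulrCA ler_piMr ?(ltW (divr_gt0 delta_gt0 n0))//.
rewrite expRN ler_pdivrMr ?expR_gt0// mul1r.
rewrite -(@ler_pXn2r _ 2)// ?nnegrE ?expR_ge0//.
rewrite -expRM_natl mulrA divff// mul1r lnK ?posrE ?divr_gt0//.
by rewrite ler_pdivlMr// expr2; move: delta_small; lra.
Qed.

Lemma sum_bad_prob : \sum_(j < n) bad_prob j <= delta.
Proof.
rewrite /bad_prob; have [m2|m2] := eqVneq m 2%N; last first.
  apply: (@le_trans _ _ (\sum_(j < n) delta / n%:R)).
    by apply: ler_sum => j _; case: ifP => // _; rewrite divr_ge0 ?ltW.
  by rewrite sumr_const card_ord -(mulr_natr (delta / n%:R)) divfK// gt_eqF.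
rewrite (eq_bigr (fun j : 'I_n => (odd j)%:R * (2 * (delta / n%:R)))); last first.
  by move=> j _; rewrite m2 dvdn2; case: odd; rewrite /= ?mul1r ?mul0r.
rewrite -mulr_suml -natr_sum sum_odd_lt.
have half : (n./2)%:R * 2 <= n%:R :> R.
  by rewrite -natrM ler_nat muln2 -[leqRHS]odd_double_half leq_addl.
have -> : (n./2)%:R * (2 * (delta / n%:R)) = (n./2)%:R * 2 * delta / n%:R by ring.
by rewrite ler_pdivrMr// mulrC ler_pM2l.
Qed.

Lemma penalty_dominates_noise :
  exists2 A, measurable A /\ (P A <= delta%:E)%E &
  forall w, ~ A w ->
    forall j : 'I_n, `|dot (res j) (noise xi w)| <= n%:R * lambda.
Proof.
pose B (j : nat) := [set w | n%:R * lambda < `|dot (res j) (noise xi w)|].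
have mB j : measurable (B j).
  apply: measurable_gt_set; apply: measurableT_comp => //.
  exact: measurable_dot_noise.
exists (\big[setU/set0]_(j < n) B j).
  split; first by apply: bigsetU_measurable => j _; exact: mB.
  apply: le_trans (Boole_inequality _ _) _; first by move=> j _; exact: mB.
  apply: (@le_trans _ _ (\sum_(j < n) (bad_prob j)%:E)%E).
    by apply: lee_sum => j _; exact: residual_tail.
  by rewrite sumEFin lee_fin sum_bad_prob.
move=> w nAw j; rewrite leNgt; apply/negP => bad; apply: nAw.
by rewrite -bigcup_mkord; exists j => /=.
Qed.

(** The exceptional set is produced as a measurable set, so that any measurable
event containing its complement has probability at least [1 - 2 * delta]. *)
Lemma noise_event :
  exists2 A, measurable A /\ (P A <= (2 * delta)%:E)%E &
  forall w, ~ A w ->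
    (forall j : 'I_n, `|dot (res j) (noise xi w)| <= n%:R * lambda) /\
    \sum_(b < block_count n m) dot (block_vec R n m b) (noise xi w) ^+ 2 <=
      sigma ^+ 2 * (2 * k%:R + 4 * ln (1 / delta)).
Proof.
have [A [mA PA] nA] := penalty_dominates_noise.
have ou := block_vec_orthonormal R n_gt0 (ltn0Sn (n.-1 %/ k)).
have chi := chi_square_tail sigma_gt0 hxi (ln (1 / delta)) ou.
set C := [set w | _] in chi.
have mC : measurable C.
  by apply: measurable_ge_set; exact: measurable_sum_sq_dot_noise.
exists (A `|` C).
  split; first exact: measurableU.
  apply: le_trans (measureU2 _ mA mC) _.
  rewrite mulr_natl mulr2n EFinD leeD//; apply: le_trans chi _.
  by rewrite lee_fin div1r lnV ?posrE// opprK lnK ?posrE.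
move=> w nACw; split; first by apply: nA => Aw; apply: nACw; left.
have [_ bk] := block_length_bounds.
have : ~ C w by move=> Cw; apply: nACw; right.
move=> /negP; rewrite -ltNge => /ltW /le_trans; apply.
rewrite ler_pM2l ?exprn_gt0// lerD2r ler_pM2l// ler_nat//.
Qed.

End noise_event.

(** * The rate and the main bound *)

Section rate.
Context (R : realType).

Lemma powR_third_cube (a : R) : 0 <= a -> (a `^ (1 / 3)) ^+ 3 = a.
Proof.
move=> a0; rewrite -powR_mulrn ?powR_ge0// -powRrM.
by rewrite (_ : 1 / 3 * 3%:R = 1 :> R) ?powRr1//; field.
Qed.

Variables (V N L sigma : R).
Hypotheses (V0 : 0 <= V) (N0 : 0 < N) (L0 : 0 < L) (sigma0 : 0 < sigma).

Let x := (V ^+ 2 * N * L / sigma ^+ 2) `^ (1 / 3).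
Let r := (sigma ^+ 4 * V ^+ 2 * L / N ^+ 2) `^ (1 / 3).

Let x0 : 0 <= x. Proof. exact: powR_ge0. Qed.

Let x_cube : x ^+ 3 = V ^+ 2 * N * L / sigma ^+ 2.
Proof.
apply: powR_third_cube.
by rewrite divr_ge0 ?mulr_ge0 ?sqr_ge0// ltW.
Qed.

Lemma rate_scaling : sigma ^+ 2 * x / N = r.
Proof.
have r_cube : r ^+ 3 = sigma ^+ 4 * V ^+ 2 * L / N ^+ 2.
  apply: powR_third_cube.
  by rewrite divr_ge0 ?mulr_ge0 ?exprn_ge0 ?sqr_ge0// ltW.
apply/eqP; rewrite -(@eqrXn2 _ 3)//; last 2 first.
- by rewrite divr_ge0 ?mulr_ge0 ?sqr_ge0// ltW.
- exact: powR_ge0.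
apply/eqP; rewrite r_cube !exprMn x_cube exprVn.
by field; rewrite !gt_eqF.
Qed.

(** Substituting [V ^+ 2 * L = sigma ^+ 2 * x ^+ 3 / N] in the square of the
left-hand side gives [(sigma ^+ 2 / N) ^+ 2 * (x ^+ 3 / k)], and [x < k]. *)
Lemma penalty_le_rate k : x < k -> sigma * Num.sqrt (L / (k * N)) * V <= r.
Proof.
move=> xk; have k0 : 0 < k by exact: le_lt_trans xk.
rewrite -rate_scaling -(@ler_pXn2r _ 2)// ?nnegrE; last 2 first.
- by rewrite !mulr_ge0 ?sqrtr_ge0// ltW.
- by rewrite divr_ge0 ?mulr_ge0 ?sqr_ge0// ltW.
rewrite !exprMn sqr_sqrtr; last by rewrite ltW// divr_gt0// mulr_gt0.
have s0 : sigma != 0 by rewrite gt_eqF.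
have NN0 : N != 0 by rewrite gt_eqF.
have -> : sigma ^+ 2 * (L / (k * N)) * V ^+ 2 =
    (sigma ^+ 2 / N) ^+ 2 * (x ^+ 3 / k).
  by rewrite x_cube; field; rewrite s0 NN0 gt_eqF.
have -> : (sigma ^+ 2) ^+ 2 * x ^+ 2 * N^-1 ^+ 2 = (sigma ^+ 2 / N) ^+ 2 * x ^+ 2.
  by field.
rewrite ler_wpM2l ?sqr_ge0// ler_pdivrMr// exprSr.
by rewrite ler_wpM2l ?sqr_ge0// (ltW xk).
Qed.

End rate.

Theorem proposition6 (R : realType) (d : measure_display)
    (T : measurableType d) (P : probability T R)
    (n : nat) (hn : (3 <= n)%N)
    (sigma : R) (hsigma : 0 < sigma)
    (fstar : 'cV[R]_n)
    (xi : 'I_n -> {RV P >-> R}) (hxi : isotropic_gaussian sigma xi)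
    (y : T -> 'cV[R]_n) (hy : forall w, y w = fstar + \col_i xi i w)
    (delta : R) (hdelta0 : 0 < delta) (hdeltan : delta < n%:R)
    (fup : 'cV[R]_n)
    (hfup : is_projection (@nondecreasing_cone R n) fstar fup)
    (k : int)
    (hk : smallest_integer_larger
            ((TV fup ^+ 2 * n%:R * ln (n%:R / delta) / sigma ^+ 2) `^ (1 / 3)) k)
    (lambda : R)
    (hlambda : lambda =
       sigma * Num.sqrt (ln (n%:R / delta) / (k%:~R * n%:R)))
    (fhat : T -> 'cV[R]_n)
    (hfhat : forall w, TV_estimator lambda (y w) (fhat w)) :
  ((1 - 2 * delta)%:E <=
   P [set w | (n%:R^-1 * sqnorm2 (fhat w - fstar) <=
        n%:R^-1 * sqnorm2 (fup - fstar)
        + 2 * sigma ^+ 2 * (1 + 2 * ln (1 / delta)) / n%:R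
        + 6 * (sigma ^+ 4 * TV fup ^+ 2 * ln (n%:R / delta) / n%:R ^+ 2)
              `^ (1 / 3))%R])%E.
Proof.
have [delta_large|delta_small] := leP 1 (2 * delta).
  (* The claimed lower bound is then nonpositive. *)
  by apply: le_trans (measure_ge0 P _); rewrite lee_fin subr_le0.
have n_gt0 : (0 < n)%N by apply: leq_trans hn.
have n0 : 0 < n%:R :> R by rewrite ltr0n.
have delta4 : 4 * delta <= n%:R.
  have n2 : 2%:R <= n%:R :> R by rewrite ler_nat ltnW.
  by move: n2 delta_small; lra.
have L0 : 0 < ln (n%:R / delta) by apply: ln_gt0; rewrite ltr_pdivlMr// mul1r.
have V0 := TV_ge0 fup.
set x := _ `^ _ in hk; case: hk => xk kmin.
have x0 : 0 <= x by exact: powR_ge0.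
case: k => [k|k] in hlambda xk kmin *; last first.
  by have := le_lt_trans x0 xk; rewrite ltr0z.
have k_gt0 : (0 < k)%N by have := le_lt_trans x0 xk; rewrite ltr0z.
rewrite -pmulrn in hlambda xk.
have kx : k%:R <= x + 1.
  rewrite leNgt; apply/negP => xk1.
  (* Otherwise [k - 1] would be a smaller integer above [x]. *)
  have := kmin (Posz k - 1); rewrite intrD -pmulrn ltrBrDr => /(_ xk1).
  by rewrite lerBrDr gerDl.
have lambda0 : 0 <= lambda by rewrite hlambda mulr_ge0 ?sqrtr_ge0// ltW.
have hfhat' w : TV_estimator lambda (fstar + noise xi w) (fhat w).
  by rewrite /noise -hy.
set E := [set w | _].
have mE : measurable E.
  apply: measurable_le_set; apply: measurable_funM => //.
  exact: measurable_loss hfhat'.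
have [A [mA PA] nA] := noise_event n_gt0 hsigma hxi hdelta0 delta4 k_gt0 hlambda.
apply: (@le_trans _ _ (P (~` A))).
  by rewrite probability_setC// EFinB leeB.
rewrite le_measure ?inE//; first exact: measurableC.
move=> w /nA[noise_le chi_le]; rewrite /E /=.
have ou := block_vec_orthonormal R n_gt0 (ltn0Sn (n.-1 %/ k)).
have := TV_estimator_oracle n_gt0 lambda0 fup ou (hfhat' w) noise_le.
have pen := penalty_le_rate V0 n0 L0 hsigma xk; rewrite -hlambda in pen.
have := rate_scaling V0 n0 L0 hsigma; rewrite -/x.
set r := _ `^ _ in pen *; move=> scaling.
move=> oracle; rewrite -(ler_pM2l n0).
apply: (@le_trans _ _ (sqnorm2 (fup - fstar) + 4 * (n%:R * lambda * TV fup)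
    + sigma ^+ 2 * (2 * (x + 1) + 4 * ln (1 / delta)))).
  rewrite mulVKf ?gt_eqF//; apply: le_trans oracle _.
  rewrite lerD2l (le_trans chi_le)// ler_pM2l ?exprn_gt0//.
  by rewrite lerD2r ler_pM2l.
have sx : sigma ^+ 2 * x = n%:R * r by rewrite -scaling; field; rewrite gt_eqF.
have -> : n%:R * (n%:R^-1 * sqnorm2 (fup - fstar) +
      2 * sigma ^+ 2 * (1 + 2 * ln (1 / delta)) / n%:R + 6 * r) =
    sqnorm2 (fup - fstar) + 2 * sigma ^+ 2 * (1 + 2 * ln (1 / delta))
      + 6 * (n%:R * r).
  by field; rewrite gt_eqF.
have pen' : n%:R * lambda * TV fup <= n%:R * r by rewrite -mulrA ler_pM2l.
by move: pen' sx; rewrite !mulrDr; lra.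
Qed.
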